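(* Let $\epsilon$ be a desired positive constant and let $M=|\mathcal C_-|$. The final assignment obtained by the distributed auction algorithm described in the context is within $M\epsilon$ of the optimal assignment benefit of the problem $$\max_{\tilde{\mathbf z}}\ \sum_{i\in\mathcal C_-'}\sum_{j\in\mathcal C_+'}\alpha_{ij}\tilde z_{ij}\quad\text{s.t.}\quad\sum_{j\in\mathcal C_+'}\tilde z_{ij}=1\ \ (i\in\mathcal C_-),\quad \sum_{i\in\mathcal C_-'}\tilde z_{ij}=1\ \ (j\in\mathcal C_+),\quad \tilde z_{ij}\ge0\ \ (i\in\mathcal C_-',\,j\in\mathcal C_+').$$ The final assignment is optimal if $\alpha_{ij}$ is an integer for all $i\in\mathcal C_-$, $j\in\mathcal C_+$, and $\epsilon<1/M$.
   Context: $\mathcal C_-$ (clients), $\mathcal C_+$ (relays) and $\mathcal A$ (access points) are finite sets; $N=|\mathcal C_+|$; $u$ is a virtual client and $v$ a virtual relay; $\mathcal C_-'=\mathcal C_-\cup\{u\}$, $\mathcal C_+'=\mathcal C_+\cup\{v\}$. Given utility weights $b_{ijk}$ and real numbers $\lambda_k$ ($i\in\mathcal C_-'$, $j\in\mathcal C_+'$, $k\in\mathcal A$), put $w_{ij}=2$ if $i\in\mathcal C_-$ and $j\in\mathcal C_+$, $w_{ij}=1$ otherwise, and define the benefits $\alpha_{ij}=\max_{k\in\mathcal A}(b_{ijk}-\lambda_k w_{ij})$, with $\alpha_{uv}=0$. For a client, being assigned to $v$ means connecting directly to its best access point; a relay assigned to $u$ assists no client. Distributed auction algorithm with parameter $\epsilon$.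 Each client $i\in\mathcal C_-$ stores its current partner $j_i$, initially $j_i=v$, and a local vector $P_i\in\mathbb R^N$ of relay prices (its $j$-th entry $[P_i]_j$ is the price of relay $j$ as known to client $i$), initially $P_i=\mathbf 0$; the virtual relay has price $[P_i]_v=0$. Each relay $j\in\mathcal C_+$ stores its price $p_j$, initially $p_j=\alpha_{uj}$, and its current client $i_j$, initially none. Client $i$ repeatedly does the following. (1) If it receives ''no'' and a new price $p_{j_i}$ from its current partner relay $j_i$, it disconnects from $j_i$, connects to its best access point, sets $[P_i]_{j_i}\leftarrow p_{j_i}$, and then $j_i\leftarrow v$. (2) If $j_i=v\neq\arg\max_{j\in\mathcal C_+'}\{\alpha_{ij}-[P_i]_j\}$, it sets $j_i'=\arg\max_{j\in\mathcal C_+'}\{\alpha_{ij}-[P_i]_j\}$, $\theta_i=\max_{j\in\mathcal C_+'}\{\alpha_{ij}-[P_i]_j\}$, $\omega_i=\max_{j\in\mathcal C_+',\,j\neq j_i'}\{\alpha_{ij}-[P_i]_j\}$ and $\beta_i=[P_i]_{j_i'}+\theta_i-\omega_i+\epsilon$, and sends a request with bid $\beta_i$ to relay $j_i'$. It receives a response (''yes'' or ''no'') together with a price $p'$. If the response is ''yes'', it connects to $j_i'$ and sets $j_i\leftarrow j_i'$. It then sets $[P_i]_{j_i'}\leftarrow p'$. Relay $j$, when it receives a request from a client $i$ with bid $\beta_i$: if $\beta_i-p_j\ge\epsilon$, it sends ''yes'' and $p_j$ to client $i$, sends ''no'' and $p_j$ to client $i_j$ (if any), connects to client $i$, and sets $i_j\leftarrow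 i$, $p_j\leftarrow\beta_i$; otherwise it sends ''no'' and $p_j$ to client $i$. The algorithm terminates when there are no client requests. In the final assignment each client $i\in\mathcal C_-$ is assigned to its partner $j_i$, and each relay with no client is assigned to $u$; the benefit of an assignment is its objective value.
   Formalization: The formal theorem additionally assumes α_uj ≥ 0 for every relay j, and for optimality requires integrality of α_ij for all i, j including the virtual client u and virtual relay v; without these the claims fail on small examples. *)

(* Defs.v *)
From mathcomp Require Import all_boot all_order all_algebra.
From mathcomp Require Import reals.

Set Implicit Arguments.
Unset Strict Implicit.
Unset Printing Implicit Defensive.

Import Order.TTheory GRing.Theory Num.Theory.
Local Open Scope ring_scope.

(* The virtual client u and the virtual relay v are the [None] of           *)
(* [option Cm] and [option Cp]: C_-' is [option Cm], C_+' is [option Cp].    *)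

Section Benefits.
Context {R : realType} {Cm Cp A : finType}.

Definition weight (i : option Cm) (j : option Cp) : R :=
  if (i, j) is (Some _, Some _) then 2 else 1.

(* [k0] only witnesses that A is nonempty, so that the maximum makes sense;  *)
(* the value does not depend on it.                                          *)
Definition alpha (k0 : A) (b : option Cm -> option Cp -> A -> R)
    (lambda : A -> R) (i : option Cm) (j : option Cp) : R :=
  if (i, j) is (None, None) then 0
  else \big[Num.max/b i j k0 - lambda k0 * weight i j]_(k : A)
         (b i j k - lambda k * weight i j).

End Benefits.

Section Assignment.
Context {R : realType} {Cm Cp : finType}.
Variable a : option Cm -> option Cp -> R.

Definition benefit (z : option Cm -> option Cp -> R) : R :=
  \sum_(i : option Cm) \sum_(j : option Cp) a i j * z i j.

Definition feasible (z : option Cm -> option Cp -> R) : Prop :=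
  [/\ forall i : Cm, \sum_(j : option Cp) z (Some i) j = 1,
      forall j : Cp, \sum_(i : option Cm) z i (Some j) = 1
    & forall i j, 0 <= z i j].

Definition within_of_optimal (d : R) (z : option Cm -> option Cp -> R) : Prop :=
  feasible z /\ forall z', feasible z' -> benefit z' <= benefit z + d.

Definition optimal (z : option Cm -> option Cp -> R) : Prop :=
  feasible z /\ forall z', feasible z' -> benefit z' <= benefit z.

End Assignment.

Section Auction.
Context {R : realType} {Cm Cp : finType}.
Variables (a : option Cm -> option Cp -> R) (eps : R).

Variant answer := Yes | No.

Definition upd {T : eqType} {U : Type} (f : T -> U) (x : T) (y : U) : T -> U :=
  fun z => if z == x then y else f z.

(* Clients and relays run asynchronously and exchange messages.  A client    *)
(* sends nothing between a request and its response, so at most one request  *)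
(* per client is in transit; replies from relay j to client i travel through *)
(* the FIFO channel [inbox (j, i)].                                          *)
Record state := State {
  partner  : Cm -> option Cp;                   (* j_i, with v = None *)
  known    : Cm -> Cp -> R;                     (* [P_i]_j *)
  awaiting : Cm -> option Cp;                   (* relay whose response i awaits *)
  price    : Cp -> R;                           (* p_j *)
  client   : Cp -> option Cm;                   (* i_j *)
  request  : Cm -> option (Cp * R);             (* request in transit from i *)
  inbox    : Cp * Cm -> seq (answer * R)        (* oldest message first *)
}.

Definition init : state := {|
  partner := fun=> None;
  known := fun _ _ => 0;
  awaiting := fun=> None;
  price := fun j => a None (Some j);
  client := fun=> None;
  request := fun=> None;
  inbox := fun=> [::] |}.

Definition margin (s : state) (i : Cm) (j : option Cp) : R :=
  a (Some i) j - (if j is Some j' then known s i j' else 0).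

(* The argmax is a set: ties may be broken in any way, differently at each   *)
(* iteration.                                                                *)
Definition is_argmax (s : state) (i : Cm) (j : option Cp) : Prop :=
  forall j', margin s i j' <= margin s i j.

Definition theta (s : state) (i : Cm) : R :=
  \big[Num.max/margin s i None]_(j : option Cp) margin s i j.

(* Seeding the maximum with the margin of v is harmless: v differs from the  *)
(* real relay j'.                                                            *)
Definition omega (s : state) (i : Cm) (j' : Cp) : R :=
  \big[Num.max/margin s i None]_(j : option Cp | j != Some j') margin s i j.

Definition bid (s : state) (i : Cm) (j' : Cp) : R :=
  known s i j' + theta s i - omega s i j' + eps.

Definition learn (s : state) (i : Cm) (j : Cp) (p : R) : Cm -> Cp -> R :=
  upd (known s) i (upd (known s i) j p).

Definition send (ch : Cp * Cm -> seq (answer * R)) (j : Cp) (i : Cm)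
    (m : answer * R) : Cp * Cm -> seq (answer * R) :=
  upd ch (j, i) (rcons (ch (j, i)) m).

(* As in the algorithm, an accepting relay sends its price before updating   *)
(* it to the new bid.                                                        *)
Inductive step (s : state) : state -> Prop :=
| step_disconnect i j p q :
    awaiting s i = None -> partner s i = Some j ->
    inbox s (j, i) = (No, p) :: q ->
    step s {| partner := upd (partner s) i None;
              known := learn s i j p;
              awaiting := awaiting s;
              price := price s;
              client := client s;
              request := request s;
              inbox := upd (inbox s) (j, i) q |}
| step_request i j :
    awaiting s i = None -> partner s i = None -> is_argmax s i (Some j) ->
    step s {| partner := partner s;
              known := known s;
              awaiting := upd (awaiting s) i (Some j);
              price := price s;
              client := client s;
              request := upd (request s) i (Some (j, bid s i j));
              inbox := inbox s |}
| step_accept i j beta :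
    request s i = Some (j, beta) -> eps <= beta - price s j ->
    step s {| partner := partner s;
              known := known s;
              awaiting := awaiting s;
              price := upd (price s) j beta;
              client := upd (client s) j (Some i);
              request := upd (request s) i None;
              inbox := let ch := send (inbox s) j i (Yes, price s j) in
                       if client s j is Some i' then send ch j i' (No, price s j)
                       else ch |}
| step_reject i j beta :
    request s i = Some (j, beta) -> beta - price s j < eps ->
    step s {| partner := partner s;
              known := known s;
              awaiting := awaiting s;
              price := price s;
              client := client s;
              request := upd (request s) i None;
              inbox := send (inbox s) j i (No, price s j) |}
| step_response i j r p q :
    awaiting s i = Some j -> inbox s (j, i) = (r, p) :: q ->
    step s {| partner := if r is Yes then upd (partner s) i (Some j)
                         else partner s;
              known := learn s i j p;
              awaiting := upd (awaiting s) i None;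
              price := price s;
              client := client s;
              request := request s;
              inbox := upd (inbox s) (j, i) q |}.

Inductive reachable : state -> Prop :=
| reachable_init : reachable init
| reachable_step s s' : reachable s -> step s s' -> reachable s'.

(* No message is in transit and no client has a request to send. *)
Definition terminated (s : state) : Prop :=
  [/\ forall i, request s i = None,
      forall i, awaiting s i = None,
      forall ji, inbox s ji = [::]
    & forall i, partner s i = None -> is_argmax s i None].

(* The pair (u, v) is unconstrained and has benefit 0; it is left out. *)
Definition final_assignment (s : state) (i : option Cm) (j : option Cp) : R :=
  match i, j with
  | Some i, _ => (partner s i == j)%:R
  | None, Some j => (client s j == None)%:R
  | None, None => 0
  end.

End Auction.

(* Main.v *)
Require Import Defs.
From mathcomp Require Import all_boot all_order all_algebra.
From mathcomp Require Import reals ring lra.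

(** Relay prices only increase, and a client never overestimates them.  Hence,
    when relay j accepts a bid, the bidder i is within [eps] of its best profit
    at the true prices, and it stays so as long as it is the client of j.  On
    termination the assignment and the prices thus satisfy complementary
    slackness up to [eps] per client, and linear programming duality bounds the
    gap by [M * eps].  For integer benefits, rounding [p + t] down for a suitable
    shift [t] in [0, 1) turns the prices into exact dual optima: [t] exists
    because each client rules out a set of shifts of measure [eps] and
    [M * eps < 1].  This also handles fractional competitors, without the
    integrality of the assignment polytope. *)

Set Implicit Arguments.
Unset Strict Implicit.
Unset Printing Implicit Defensive.

Import Order.TTheory GRing.Theory Num.Theory.
Local Open Scope ring_scope.

(** * Linear programming duality *)

Lemma big_option (V : nmodType) (T : finType) (F : option T -> V) :
  \sum_x F x = F None + \sum_x F (Some x).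
Proof.
rewrite (bigD1 None) //=; congr (_ + _).
rewrite (reindex_omap Some id) /=; last by case.
by apply: eq_bigl => x; rewrite eqxx.
Qed.

(** * Choice of a rounding shift *)

Section Shift.
Variable R : archiRealFieldType.

(** Raising [x] by [1 / n.+1] shifts the index by one: the term [k = 0] leaves and returns at the
    end increased by 1. *)
Lemma sum_floor_shift (n m : nat) (x : R) :
  \sum_(k < n.+1) Num.floor (x + m%:R / n.+1%:R + k%:R / n.+1%:R) =
  \sum_(k < n.+1) Num.floor (x + k%:R / n.+1%:R) + m%:R.
Proof.
elim: m => [|m IHm]; first by rewrite mul0r !addr0.
rewrite -[X in _ = _ + X]natr1 addrA -IHm big_ord_recr [in RHS]big_ord_recl /=.
rewrite [RHS]addrAC [RHS]addrC; congr (_ + _).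
  apply: eq_bigr => k _; congr (Num.floor _).
  by rewrite /bump -!natr1; field; rewrite natr1 pnatr_eq0.
rewrite -[X in _ = _ + X](floor1 R) -floorDrz ?rpred1 //.
by congr (Num.floor _); rewrite -natr1; field; rewrite addrC natr1 pnatr_eq0.
Qed.

(* Among the shifts t = k / N, the i-th condition fails for at most             *)
(* ceil (N * d) values of k, as the sum over k of floor (y + k / N) telescopes   *)
(* when y moves by 1 / N; for large N the #|I| * ceil (N * d) failures leave a   *)
(* good k.                                                                      *)
Lemma exists_shift (I : finType) (x : I -> R) (d : R) :
  0 < d -> #|I|%:R * d < 1 ->
  exists2 t, 0 <= t < 1 & forall i, Num.floor (x i + t - d) = Num.floor (x i + t).
Proof.
move=> d_gt0 Id_lt1.
(* [n.+1] is the number N of candidate shifts, so large that [#|I| * (N * d + 1) < N]; [m] is at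
   most [N * d + 1]. *)
pose n := Num.truncn (#|I|%:R / (1 - #|I|%:R * d)).
pose m := (Num.truncn (n.+1%:R * d)).+1.
have nV_gt0 : 0 < n.+1%:R :> R by rewrite ltr0n.
have le_dm : d <= m%:R / n.+1%:R.
  by rewrite ler_pdivlMr // mulrC ltW // truncnS_gt.
have bad_lt : (#|I| * m < n.+1)%N.
  have I_lt : #|I|%:R < n.+1%:R * (1 - #|I|%:R * d).
    by rewrite -ltr_pdivrMr ?subr_gt0 // truncnS_gt.
  rewrite -(ltr_nat R) natrM -[X in _ * X]natr1.
  have : (m.-1%:R : R) <= n.+1%:R * d by rewrite -truncn_ge_nat ?mulr_ge0 ?ltW.
  move=> /(ler_wpM2l (ler0n R #|I|)); lra.
pose bad i (k : 'I_n.+1) :=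
  Num.floor (x i + k%:R / n.+1%:R) - Num.floor (x i + k%:R / n.+1%:R - d).
have bad_ge0 i k : 0 <= bad i k.
  by rewrite subr_ge0 le_floor // gerBl ltW.
have sum_bad i : \sum_k bad i k <= m%:R.
  rewrite sumrB lerBlDr -lerBlDl.
  have := sum_floor_shift n m (x i - m%:R / n.+1%:R).
  rewrite subrK => ->; rewrite addrK.
  apply: ler_sum => k _; by rewrite le_floor // addrAC lerD2l lerN2.
have [k /forallP good] : exists k, [forall i, bad i k == 0].
  (* If every shift failed for some [i], the total of [bad] would be at least N, yet it is at most
     [#|I| * m]. *)
  apply/existsP; apply: contraLR bad_lt; rewrite negb_exists => /forallP none.
  rewrite -leqNgt -lez_nat.
  have : \sum_(k < n.+1) 1 <= \sum_(k < n.+1) \sum_i bad i k.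
    apply: ler_sum => k _; have := none k; rewrite negb_forall => /existsP[i].
    rewrite (bigD1 i) //= => bad_ik.
    rewrite -[1]addr0 lerD ?sumr_ge0 //.
    by rewrite -gtz0_ge1 lt_neqAle eq_sym bad_ik bad_ge0.
  rewrite sumr_const card_ord [1 *+ _]natz exchange_big /= => /le_trans; apply.
  apply: (@le_trans _ _ (\sum_(i : I) m%:R)); first exact: ler_sum.
  by rewrite sumr_const -mulrnA mulnC natz.
exists (k%:R / n.+1%:R).
  by rewrite divr_ge0 //= ltr_pdivrMr // mul1r ltr_nat ltn_ord.
by move=> i; apply/esym/eqP; rewrite -subr_eq0 good.
Qed.

End Shift.

(** * Dual certificates *)

Section Duality.
Context {R : realType} {Cm Cp : finType}.
Implicit Types (a z : option Cm -> option Cp -> R) (s : @state R Cm Cp).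

(** The two records may disagree while messages are in transit. *)
Definition consistent s :=
  forall i j, (partner s i == Some j) = (client s j == Some i).

(* Dual feasibility and complementary slackness, the latter up to [d] on the  *)
(* clients' side; the dual variable of client i is its profit.                *)
Definition slackness a (d : R) s (p : option Cp -> R) :=
  [/\ p None = 0,
      forall j, a None (Some j) <= p (Some j),
      forall j, client s j = None -> p (Some j) = a None (Some j)
    & forall i j, a (Some i) j - p j <= a (Some i) (partner s i) - p (partner s i) + d].

Lemma final_assignment_feasible s :
  consistent s -> feasible (final_assignment s).
Proof.
move=> cons; split=> [i|j|[i|] [j|]] //=.
- rewrite (bigD1 (partner s i)) //= eqxx big1 ?addr0 // => j.
  by rewrite eq_sym => /negPf->.
- rewrite big_option /=; under eq_bigr do rewrite cons.
  case: (client s j) => [i|] /=; last by rewrite big1 ?addr0.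
  rewrite add0r (bigD1 i) //= eqxx big1 ?addr0 // => i'.
  by rewrite (inj_eq Some_inj) eq_sym => /negPf->.
Qed.

(** The equality constraints give a potential the same benefit, the dual objective, at every
    feasible point. *)
Lemma benefit_potential (q : Cm -> R) (p : option Cp -> R) z :
  p None = 0 -> feasible z ->
  benefit (fun i j => (if i is Some i' then q i' else 0) + p j) z =
  \sum_i q i + \sum_j p j.
Proof.
move=> p0 [zi zj _]; rewrite /benefit.
under eq_bigr do (under eq_bigr do rewrite mulrDl); rewrite /=.
under eq_bigr do rewrite big_split /=.
rewrite big_split /= big_option; congr (_ + _).
  rewrite big1 ?add0r; last by move=> j _; rewrite mul0r.
  by apply: eq_bigr => i _; rewrite -mulr_sumr zi mulr1.
rewrite exchange_big /= big_option [in RHS]big_option p0; congr (_ + _).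
  by rewrite big1 // => i _; rewrite mul0r.
by apply: eq_bigr => j _; rewrite -mulr_sumr zj mulr1.
Qed.

(** Weak duality: the potential [A] dominates [a], and on the support of the final assignment it
    exceeds [a] by at most [d] per client. *)
Lemma slackness_within a (d : R) s (p : option Cp -> R) :
  a None None = 0 -> consistent s -> 0 <= d -> slackness a d s p ->
  within_of_optimal a (#|Cm|%:R * d) (final_assignment s).
Proof.
move=> a0 cons d_ge0 [p0 p_ge p_eq cs]; have fs := final_assignment_feasible cons.
split=> // z' fz'.
pose q i := a (Some i) (partner s i) - p (partner s i) + d.
pose A (i : option Cm) j := (if i is Some i' then q i' else 0) + p j.
have -> : #|Cm|%:R * d = benefit (fun i _ => if i is Some _ then d else 0) (final_assignment s).
  rewrite /benefit big_option big1 => [|j _]; last by rewrite mul0r.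
  case: fs => fs _ _; under eq_bigr do rewrite -mulr_sumr fs mulr1.
  by rewrite sumr_const add0r mulr_natl.
apply: (@le_trans _ _ (benefit A z')).
  case: fz' => _ _ z'_ge0; apply: ler_sum => i _; apply: ler_sum => j _.
  apply: ler_wpM2r => //; rewrite /A /q.
  case: i => [i|]; first by have := cs i j; lra.
  by case: j => [j|]; rewrite add0r ?p_ge // a0 p0.
rewrite (benefit_potential q p0 fz') -(benefit_potential q p0 fs) /benefit.
rewrite -big_split ler_sum //= => i _; rewrite -big_split ler_sum //= => j _.
rewrite -mulrDl /q; case: i => [i|] /=.
  by case: eqVneq => [<-|_]; rewrite ?mulr0 // !mulr1; lra.
case: j => [j|]; last by rewrite !mulr0.
by case: eqVneq => [/p_eq->|_]; rewrite ?mulr0 // add0r addr0.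
Qed.

(* Rounding the shifted prices down makes the slackness exact: the shift is   *)
(* chosen so that lowering the price of each partner by [d] first does not    *)
(* change its integer part.                                                   *)
Lemma slackness_round a (d : R) s p :
  (forall i j, a i j \is a Num.int) -> 0 < d -> #|Cm|%:R * d < 1 ->
  slackness a d s p -> exists p', slackness a 0 s p'.
Proof.
move=> a_int d_gt0 Md_lt1 [p0 p_ge p_eq cs].
have [t /andP[t0 t1] good] :=
  exists_shift (fun i => p (partner s i)) d_gt0 Md_lt1.
(* As [0 <= t < 1], rounding fixes integers, hence [p None] and the prices of free relays. *)
have floor_t (x : R) : x \is a Num.int -> (Num.floor (x + t))%:~R = x.
  move=> x_int; rewrite floorDzr // intrD floorK //.
  by have /eqP-> : Num.floor t == 0; rewrite ?addr0 // floor_eq t0.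
exists (fun j => (Num.floor (p j + t))%:~R); split.
- by rewrite p0 floor_t.
- by move=> j; rewrite -[leLHS](floor_t) // ler_int le_floor // lerD2r.
- by move=> j /p_eq->; rewrite floor_t.
- move=> i j /=; rewrite addr0.
  set pi := p (partner s i); set c := a (Some i) (partner s i).
  have c_int : c - a (Some i) j \is a Num.int by rewrite rpredB ?a_int.
  suff: (Num.floor (pi + t))%:~R <=
        (Num.floor (p j + t))%:~R + (c - a (Some i) j) by lra.
  (* By [good], the left floor is that of [pi + t - d], which absorbs the slack [d]. *)
  rewrite -(floorK c_int) -intrD ler_int -floorDrz // -good.
  by apply: le_floor; have := cs i j; rewrite -/pi -/c; lra.
Qed.

End Duality.

(** * Invariants of the auction *)

Section Invariants.
Context {R : realType} {Cm Cp : finType}.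
Variables (a : option Cm -> option Cp -> R) (eps : R).
Implicit Types s : @state R Cm Cp.

(* The joint states of a client i and the relay j: partner and awaited relay  *)
(* of i, target of the request in transit from i, whether i is the client of  *)
(* j, and the answers in transit from j to i.                                 *)
Inductive phase (j : Cp) :
  option Cp -> option Cp -> option Cp -> bool -> seq answer -> Prop :=
| Unrelated pa aw rq of pa <> Some j & aw <> Some j & rq <> Some j :
    phase j pa aw rq false [::]
| Requested : phase j None (Some j) (Some j) false [::]
| Rejected : phase j None (Some j) None false [:: No]
| Accepted : phase j None (Some j) None true [:: Yes]
| AcceptedOutbid : phase j None (Some j) None false [:: Yes; No]
| Connected : phase j (Some j) None None true [::]
| Outbid : phase j (Some j) None None false [:: No].

Definition phase_of s i j :=
  phase j (partner s i) (awaiting s i) (omap fst (request s i))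
    (client s j == Some i) (map fst (inbox s (j, i))).

Lemma updE {T : eqType} {U : Type} (f : T -> U) x y z :
  upd f x y z = if z == x then y else f z.
Proof. by []. Qed.

Lemma init_phase i j : phase_of (init a) i j.
Proof. exact: Unrelated. Qed.

(** * Effect of each event, at relay [j0], on the phase of any relay [j] *)

Section Transitions.
Variables (j j0 : Cp) (pa aw rq : option Cp) (cl : bool) (ms : seq answer).

Local Ltac by_transition :=
  case: (eqVneq j j0) => [?|/eqP ?]; subst;
  inversion 1; subst => /=; solve [congruence|constructor; congruence].

Lemma phase_disconnect :
  phase j (Some j0) None rq cl (if j == j0 then No :: ms else ms) ->
  phase j None None rq cl ms.
Proof. by_transition. Qed.

Lemma phase_request :
  phase j None None rq cl ms ->
  phase j None (Some j0) (Some j0) cl ms.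
Proof. by_transition. Qed.

Lemma requesting_not_client : phase j pa aw (Some j) cl ms -> cl = false.
Proof. by inversion 1. Qed.

Lemma phase_accept :
  phase j pa aw (Some j0) cl ms ->
  phase j pa aw None (if j == j0 then true else cl)
    (if j == j0 then rcons ms Yes else ms).
Proof. by_transition. Qed.

Lemma phase_reject :
  phase j pa aw (Some j0) cl ms ->
  phase j pa aw None cl (if j == j0 then rcons ms No else ms).
Proof. by_transition. Qed.

Lemma phase_outbid :
  phase j pa aw rq true ms -> phase j pa aw rq false (rcons ms No).
Proof. by_transition. Qed.

Lemma phase_response r :
  phase j pa (Some j0) rq cl (if j == j0 then r :: ms else ms) ->
  phase j (if r is Yes then Some j0 else pa) None rq cl ms.
Proof. case: r; by_transition. Qed.

End Transitions.

Lemma quiescent_phase j pa cl :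
  phase j pa None None cl [::] -> (pa == Some j) = cl.
Proof. by inversion 1; subst; rewrite ?eqxx //; apply/eqP. Qed.

Lemma step_phase s s' :
  step a eps s s' -> (forall i j, phase_of s i j) -> forall i j, phase_of s' i j.
Proof.
case=> {s'}[i0 j0 p q aw pa ib|i0 j0 aw pa am|i0 j0 beta rq le|i0 j0 beta rq lt
           |i0 j0 r p q aw ib] ph i j;
  have := ph i j; rewrite /phase_of /= /send.
- rewrite !updE xpair_eqE; case: (eqVneq i i0) => [->|_]; last by rewrite andbF.
  rewrite aw pa andbT => H; apply: (@phase_disconnect _ j0); move: H.
  by case: (eqVneq j j0) => [->|//]; rewrite ib.
- rewrite !updE; case: (eqVneq i i0) => [->|//].
  by rewrite aw pa; apply: phase_request.
(* The outbid client is not the bidder, so [Yes] and [No] enter different channels. *)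
- have client_j0 : client s j0 != Some i0.
    have := ph i0 j0; rewrite /phase_of rq /= => /requesting_not_client.
    by move/negbT.
  rewrite !updE; case: (eqVneq i i0) => [->|ni].
    rewrite rq => /phase_accept; case: (eqVneq j j0) => [->|nj].
      rewrite eqxx; case E: (client s j0) client_j0 => [i1|] ni1;
        rewrite ?updE ?xpair_eqE ?eqxx ?map_rcons //.
      by rewrite eq_sym -(inj_eq Some_inj) (negPf ni1) map_rcons.
    by case: (client s j0) => [i1|]; rewrite !updE !xpair_eqE (negPf nj).
  case: (eqVneq j j0) => [->|nj]; last first.
    by case: (client s j0) => [i1|]; rewrite !updE !xpair_eqE (negPf nj).
  rewrite (inj_eq Some_inj) [i0 == i]eq_sym (negPf ni).
  case E: (client s j0) client_j0 => [i1|] ni1;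
    rewrite !updE !xpair_eqE !eqxx ?(negPf ni) //=.
  rewrite (inj_eq Some_inj) in ni1; rewrite (negPf ni1) (inj_eq Some_inj) eq_sym.
  case: (eqVneq i i1) => [->|//].
  by rewrite map_rcons; apply: phase_outbid.
- rewrite !updE xpair_eqE; case: (eqVneq i i0) => [->|_]; last by rewrite andbF.
  rewrite rq andbT => /phase_reject.
  by case: (eqVneq j j0) => [->|//]; rewrite map_rcons.
- rewrite !updE xpair_eqE; case: (eqVneq i i0) => [->|ni]; last first.
    by case: r {ib}; rewrite ?updE ?(negPf ni) andbF.
  rewrite aw andbT => H.
  suff /phase_response : phase j (partner s i0) (Some j0)
      (omap fst (request s i0)) (client s j == Some i0)
      (if j == j0 then r :: map fst (if j == j0 then q else inbox s (j, i0))
       else map fst (if j == j0 then q else inbox s (j, i0))).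
    by case: r {ib}; rewrite ?updE ?eqxx.
  by move: H; case: (eqVneq j j0) => [->|//]; rewrite ib.
Qed.

Lemma reachable_phase s i j : reachable a eps s -> phase_of s i j.
Proof.
move=> rs; elim: rs i j => [i j|s1 s2 _ IH /step_phase]; last exact.
exact: init_phase.
Qed.

(** * Price invariants *)

Definition relay_price s (j : option Cp) : R :=
  if j is Some j' then price s j' else 0.

(** This is [eps]-complementary slackness at price [x]; [j] is excluded because its current price
    may lie below a pending bid [x]. *)
Definition almost_best s i j (x : R) :=
  forall j', j' != Some j ->
    a (Some i) j' - relay_price s j' <= a (Some i) (Some j) - x + eps.

Record price_inv s : Prop := PriceInv {
  price_ge : forall j, a None (Some j) <= price s j;
  price_free : forall j, client s j = None -> price s j = a None (Some j);
  known_le : forall i j, known s i j <= price s j;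
  inbox_le : forall i j, all (fun m => m.2 <= price s j) (inbox s (j, i));
  request_best : forall i j beta,
    request s i = Some (j, beta) -> almost_best s i j beta;
  client_best : forall i j,
    client s j = Some i -> almost_best s i j (price s j) }.

Lemma init_price_inv :
  (forall j, 0 <= a None (Some j)) -> price_inv (init a).
Proof. by move=> a_ge0; split. Qed.

Lemma almost_best_mono s s' i j x :
  (forall j', price s j' <= price s' j') ->
  almost_best s i j x -> almost_best s' i j x.
Proof.
move=> le_price best j' /best; apply: le_trans.
by case: j' => [j'|] //=; rewrite lerD2l lerN2.
Qed.

(** The bid leaves profit [omega - eps] at [j]; since known prices are lower bounds, no alternative
    truly yields more than [omega]. *)
Lemma bid_best s i j : (forall j', known s i j' <= price s j') ->
  is_argmax a s i (Some j) -> almost_best s i j (bid a eps s i j).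
Proof.
move=> known_le amax j' ne_j'.
have -> : bid a eps s i j = a (Some i) (Some j) - omega a s i j + eps.
  rewrite /bid; suff -> : theta a s i = a (Some i) (Some j) - known s i j by lra.
  apply/eqP; rewrite eq_le; apply/andP; split; last exact: le_bigmax.
  by apply: bigmax_le.
have : a (Some i) j' - relay_price s j' <= margin a s i j'.
  by case: j' {ne_j'} => [j'|]; rewrite /margin ?lerD2l ?lerN2.
have : margin a s i j' <= omega a s i j by apply: le_bigmax_cond.
lra.
Qed.

Lemma learn_le s (pr : Cp -> R) i j x :
  (forall i j, known s i j <= pr j) -> x <= pr j ->
  forall i' j', learn s i j x i' j' <= pr j'.
Proof.
move=> known_le x_le i' j'; rewrite /learn !updE.
case: eqP => _ //; rewrite updE; case: eqP => [->|_] //.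
Qed.

Lemma send_le (ch : Cp * Cm -> seq (answer * R)) (pr : Cp -> R) j i m :
  (forall i j, all (fun m => m.2 <= pr j) (ch (j, i))) -> m.2 <= pr j ->
  forall i' j', all (fun m => m.2 <= pr j') (send ch j i m (j', i')).
Proof.
move=> ch_le m_le i' j'; rewrite /send updE xpair_eqE.
by case: (eqVneq j' j) => [->|] //; case: eqP => //= _; rewrite all_rcons m_le ch_le.
Qed.

Lemma step_price_inv s s' :
  0 < eps -> step a eps s s' -> price_inv s -> price_inv s'.
Proof.
move=> eps_gt0 st [ge_a free kn_le in_le rq_best cl_best].
case: st => {s'}[i0 j0 p q aw pa ib|i0 j0 aw pa am|i0 j0 beta rq le|i0 j0 beta rq lt
           |i0 j0 r p q aw ib].
- have /andP[p_le q_le] : (p <= price s j0) && all (fun m => m.2 <= price s j0) q.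
    by have := in_le i0 j0; rewrite ib.
  split=> //=; first exact: learn_le.
  by move=> i j; rewrite updE xpair_eqE; case: eqP => [->|] //=; case: eqP.
- split=> //= i j beta; rewrite updE; case: eqP => [->|_]; last exact: rq_best.
  by case=> <- <-; exact: (bid_best (kn_le i0) am).
- have price_le j : price s j <= upd (price s) j0 beta j.
    by rewrite updE; case: eqP => [->|_] //; lra.
  have in_le' i j : all (fun m => m.2 <= upd (price s) j0 beta j) (inbox s (j, i)).
    by apply: sub_all (in_le i j) => m /le_trans; apply.
  split=> //=.
  + by move=> j; apply: le_trans (price_le j).
  + by move=> j; rewrite !updE; case: eqP => [_|_ /free].
  + by move=> i j; apply: le_trans (price_le j).
  (* Both answers carry the old price, which is at most the new one. *)
  + case: (client s j0) => [i1|]; repeat apply: send_le => //=.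
  + move=> i j x; rewrite updE; case: eqP => // _ /rq_best.
    exact: almost_best_mono.
  + move=> i j; rewrite !updE; case: eqP => [->|_]; last first.
      by move=> /cl_best; apply: almost_best_mono.
    (* The accepted bid becomes the price, so its bound passes from the request to the client. *)
    by case=> <-; apply: almost_best_mono (rq_best _ _ _ rq).
- split=> //=; first exact: send_le.
  by move=> i j x; rewrite updE; case: eqP => // _ /rq_best.
- have /andP[p_le q_le] : (p <= price s j0) && all (fun m => m.2 <= price s j0) q.
    by have := in_le i0 j0; rewrite ib.
  split=> //=; first exact: learn_le.
  by move=> i j; rewrite updE xpair_eqE; case: eqP => [->|] //=; case: eqP.
Qed.

Lemma reachable_price_inv s :
  0 < eps -> (forall j, 0 <= a None (Some j)) ->
  reachable a eps s -> price_inv s.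
Proof.
move=> eps_gt0 a_ge0; elim=> [|s1 s2 _ IH st]; first exact: init_price_inv.
exact: step_price_inv st IH.
Qed.

(** * Terminal states *)

Lemma terminated_consistent s :
  reachable a eps s -> terminated a s -> consistent s.
Proof.
move=> rs [rq aw ib _] i j; apply: quiescent_phase.
by have := reachable_phase i j rs; rewrite /phase_of rq aw ib.
Qed.

(** A connected client inherits [client_best]; for the others v is best at the known prices, hence
    also at the true ones, which are no lower. *)
Lemma terminated_slackness s :
  0 < eps -> (forall j, 0 <= a None (Some j)) ->
  reachable a eps s -> terminated a s -> slackness a eps s (relay_price s).
Proof.
move=> eps_gt0 a_ge0 rs ts.
have [ge_a free kn_le _ _ cl_best] := reachable_price_inv eps_gt0 a_ge0 rs.
split=> // i j; case pa: (partner s i) => [j0|].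
  have /eqP/cl_best best : client s j0 == Some i.
    by rewrite -(terminated_consistent rs ts) pa.
  have [->|/best//] := eqVneq j (Some j0); first by lra.
case: ts => _ _ _ /(_ i pa j); rewrite /margin /=.
by case: j => [j|] /=; first have := kn_le i j; lra.
Qed.

End Invariants.

Theorem mainTheorem5 (R : realType) (Cm Cp A : finType) (k0 : A)
    (b : option Cm -> option Cp -> A -> R) (lambda : A -> R) (eps : R)
    (eps_gt0 : 0 < eps)
    (alpha_u_ge0 : forall j : Cp, 0 <= alpha k0 b lambda None (Some j))
    (s : @state R Cm Cp)
    (s_reachable : reachable (alpha k0 b lambda) eps s)
    (s_terminated : terminated (alpha k0 b lambda) s) :
  within_of_optimal (alpha k0 b lambda) (#|Cm|%:R * eps) (final_assignment s)
  /\ ((forall (i : option Cm) (j : option Cp),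
         alpha k0 b lambda i j \is a Num.int) ->
      eps < 1 / #|Cm|%:R ->
      optimal (alpha k0 b lambda) (final_assignment s)).
Proof.
have a0 : alpha k0 b lambda None None = 0 by [].
have cons := terminated_consistent s_reachable s_terminated.
have slack := terminated_slackness eps_gt0 alpha_u_ge0 s_reachable s_terminated.
split=> [|a_int eps_lt]; first exact: slackness_within (ltW eps_gt0) slack.
have M_eps_lt1 : #|Cm|%:R * eps < 1.
  (* Division by [#|Cm|] is meaningful only when there is a client; otherwise the product is 0. *)
  have [M0|M_gt0] := posnP #|Cm|; first by rewrite M0 mul0r.
  by rewrite mulrC -ltr_pdivlMr // ltr0n.
have [p p_slack] := slackness_round a_int eps_gt0 M_eps_lt1 slack.
have [fz opt] := slackness_within a0 cons (lexx 0) p_slack.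
by split=> // z' /opt; rewrite mulr0 addr0.
Qed.
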